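(* For every integer $n\ge 3$, $\tilde{r}(C_3,P_n)\le 3n-4$.
   Context: In the online size Ramsey game $\mathcal R(H_1,H_2)$, played on the edge set of the infinite complete graph $K_{\mathbb N}$, in each round Builder selects a previously unselected edge and Painter colours it red or blue; the game ends as soon as there is a red copy of $H_1$ or a blue copy of $H_2$. Builder tries to end the game as soon as possible, Painter tries to delay it, and $\tilde r(H_1,H_2)$ is the number of rounds under optimal play of both players. $C_3$ is the triangle and $P_n$ is the path on $n$ vertices. *)

(* Defs.v *)
From Stdlib Require Import List Arith.
Import ListNotations.

(* Colours: true = red, false = blue. *)
(* A history is the list of coloured edges so far (most recent first);
   an entry (x, y, c) means the edge {x, y} of K_N got colour c. *)
Definition history := list (nat * nat * bool).

Definition colored (h : history) (x y : nat) (c : bool) : Prop :=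
  In (x, y, c) h \/ In (y, x, c) h.

Definition selected (h : history) (x y : nat) : Prop :=
  exists c, colored h x y c.

Definition red_triangle (h : history) : Prop :=
  exists a b c, a <> b /\ b <> c /\ a <> c /\
    colored h a b true /\ colored h b c true /\ colored h a c true.

Definition blue_path (n : nat) (h : history) : Prop :=
  exists f : nat -> nat,
    (forall i j, i < n -> j < n -> f i = f j -> i = j) /\
    (forall i, S i < n -> colored h (f i) (f (S i)) false).

Definition game_over (n : nat) (h : history) : Prop :=
  red_triangle h \/ blue_path n h.

(* builder_wins n k h : from position h, Builder can force the game
   R(C_3, P_n) to end within at most k further rounds, whatever Painter does. *)
Fixpoint builder_wins (n k : nat) (h : history) : Prop :=
  match k with
  | 0 => game_over n h
  | S k' => game_over n h \/
      exists x y, x <> y /\ ~ selected h x y /\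
        forall c : bool, builder_wins n k' ((x, y, c) :: h)
  end.

Definition online_ramsey_C3_Pn_le (n k : nat) : Prop := builder_wins n k [].

(* Main.v *)
Require Import Defs.
From Stdlib Require Import List Arith Lia Permutation.
Import ListNotations.

(** Builder keeps two disjoint blue paths whose heads are joined by a red edge,
    and probes a new vertex [y] from the tail of the shorter path.  A blue answer
    lengthens the shorter path.  After a red answer he joins [y] to the head of
    the longer path: blue lengthens that path and restores the red link (with the
    shorter path reversed), while red forces two further blue edges that splice
    both paths and [y] into one path.  Paths of [l] and [m] vertices are won in
    [3 n - l - m - max l m - 1] rounds, and a single path of [p >= 2] vertices in
    [3 n - 2 p - 1] rounds.  This is one round too many if the game starts with two
    red edges [x v], [x y]; so the forced blue edge [v y] is then not played but
    treated as a virtual edge of one of the paths, and played only when it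
    completes a path on [n] vertices. *)

(** * Positions, rounds and forced edges *)

Definition red (h : history) (x y : nat) : Prop := colored h x y true.
Definition blue (h : history) (x y : nat) : Prop := colored h x y false.

Lemma colored_sym h x y c : colored h x y c -> colored h y x c.
Proof. unfold colored; tauto. Qed.

Lemma colored_incl h h' x y c : incl h h' -> colored h x y c -> colored h' x y c.
Proof. unfold colored; intros Hi [H | H]; auto. Qed.

Lemma colored_dec h x y c : {colored h x y c} + {~ colored h x y c}.
Proof.
  assert (dec : forall e e' : nat * nat * bool, {e = e'} + {e <> e'})
    by (repeat decide equality).
  unfold colored.
  destruct (in_dec dec (x, y, c) h); [tauto |].
  destruct (in_dec dec (y, x, c) h); tauto.
Qed.

Lemma builder_wins_over n k h : game_over n h -> builder_wins n k h.
Proof. destruct k; simpl; auto. Qed.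

Lemma builder_wins_S n k h : builder_wins n k h -> builder_wins n (S k) h.
Proof.
  revert h; induction k as [| k IH]; intros h; [simpl; auto |].
  intros [H | (x & y & Hxy & Hs & H)]; [left; exact H |].
  right; exists x, y; repeat split; auto.
Qed.

Lemma red_triangle_intro h x y z :
  x <> y -> y <> z -> x <> z -> red h x y -> red h y z -> red h x z -> red_triangle h.
Proof. intros; exists x, y, z; repeat split; assumption. Qed.

(* The edge may already have been selected: Builder then simply saves a round. *)
Lemma builder_wins_ask n k h x y :
  1 <= k -> x <> y ->
  (forall h', incl h h' -> blue h' x y -> builder_wins n (k - 1) h') ->
  (forall h', incl h h' -> red h' x y -> builder_wins n (k - 1) h') ->
  builder_wins n k h.
Proof.
  intros Hk Hxy HB HR; destruct k as [| k]; [lia |].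
  replace (S k - 1) with k in * by lia.
  destruct (colored_dec h x y true) as [Hr | Hr];
    [apply builder_wins_S, HR; auto using incl_refl |].
  destruct (colored_dec h x y false) as [Hb | Hb];
    [apply builder_wins_S, HB; auto using incl_refl |].
  right; exists x, y; repeat split; trivial.
  - intros [[] H]; auto.
  - intros []; [apply HR | apply HB]; try (apply incl_tl, incl_refl);
      left; left; reflexivity.
Qed.

Definition red_common_neighbour (h : history) (x y : nat) : Prop :=
  exists w, w <> x /\ w <> y /\ x <> y /\ red h w x /\ red h w y.

(** A red answer would close a red triangle with the common neighbour, so only the blue answer needs
    a continuation. *)
Lemma builder_wins_forced n k h x y :
  1 <= k -> red_common_neighbour h x y ->
  (forall h', incl h h' -> blue h' x y -> builder_wins n (k - 1) h') ->
  builder_wins n k h.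
Proof.
  intros Hk (w & Hx & Hy & Hxy & Hwx & Hwy) HB.
  apply builder_wins_ask with x y; trivial.
  intros h' Hi Hr; apply builder_wins_over; left.
  apply red_triangle_intro with w x y; trivial; eapply colored_incl; eassumption.
Qed.

(** * Blue paths as lists of vertices *)

Fixpoint chain (E : nat -> nat -> Prop) (l : list nat) : Prop :=
  match l with
  | x :: ((y :: _) as t) => E x y /\ chain E t
  | _ => True
  end.

Lemma chain_impl (E E' : nat -> nat -> Prop) l :
  (forall x y, E x y -> E' x y) -> chain E l -> chain E' l.
Proof.
  intros H; induction l as [| x [| y l] IH]; simpl; trivial.
  intros [Hxy Hl]; split; [auto | exact (IH Hl)].
Qed.

Lemma chain_app (E : nat -> nat -> Prop) l z x l' :
  chain E (l ++ [z]) -> E z x -> chain E (x :: l') -> chain E (l ++ z :: x :: l').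
Proof.
  intros Hl Hzx Hl'; induction l as [| y [| y' l] IH]; [split; trivial | |].
  - destruct Hl as [Hyz _]; exact (conj Hyz (conj Hzx Hl')).
  - destruct Hl as [Hy Hl]; exact (conj Hy (IH Hl)).
Qed.

Lemma chain_rev (E : nat -> nat -> Prop) l :
  (forall x y, E x y -> E y x) -> chain E l -> chain E (rev l).
Proof.
  intros Hs; induction l as [| x [| y l] IH]; trivial.
  intros [Hxy Hl]; specialize (IH Hl); simpl in IH |- *.
  rewrite <- app_assoc; apply chain_app; auto; exact I.
Qed.

Lemma chain_nth (E : nat -> nat -> Prop) l i :
  chain E l -> S i < length l -> E (nth i l 0) (nth (S i) l 0).
Proof.
  revert l; induction i as [| i IH]; intros [| x [| y l]] Hl Hi; simpl in Hi; try lia.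
  - exact (proj1 Hl).
  - apply (IH (y :: l)); [exact (proj2 Hl) | simpl; lia].
Qed.

Lemma chain_game_over n h l :
  NoDup l -> chain (blue h) l -> n <= length l -> game_over n h.
Proof.
  intros Hd Hc Hn; right; exists (fun i => nth i l 0); split.
  - intros i j Hi Hj; apply NoDup_nth; auto; lia.
  - intros i Hi; apply (chain_nth (blue h)); auto; lia.
Qed.

(** * The virtual edge *)

(** The first alternative lets an edge that is already blue serve as a trivial virtual edge, so the
    same statements cover games in which no forced edge is left unplayed. *)
Definition forced_blue (h : history) (a b : nat) : Prop :=
  blue h a b \/ red_common_neighbour h a b.

(* Blue once the forced edge [a b] has been played. *)
Definition virtual (h : history) (a b x y : nat) : Prop :=
  blue h x y \/ (x = a /\ y = b) \/ (x = b /\ y = a).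

Lemma red_common_neighbour_incl h h' x y :
  incl h h' -> red_common_neighbour h x y -> red_common_neighbour h' x y.
Proof.
  intros Hi (w & ? & ? & ? & ? & ?); exists w.
  repeat split; trivial; eapply colored_incl; eassumption.
Qed.

Lemma forced_blue_incl h h' a b : incl h h' -> forced_blue h a b -> forced_blue h' a b.
Proof.
  intros Hi [H | H]; [left; eapply colored_incl | right; eapply red_common_neighbour_incl];
    eassumption.
Qed.

Lemma virtual_incl h h' a b x y : incl h h' -> virtual h a b x y -> virtual h' a b x y.
Proof. intros Hi [H | H]; [left; eapply colored_incl; eassumption | right; exact H]. Qed.

Lemma virtual_sym h a b x y : virtual h a b x y -> virtual h a b y x.
Proof. intros [H | H]; [left; apply colored_sym, H | right; tauto]. Qed.

(** One round is kept in reserve for the virtual edge [a b]: once it is blue, every edge of the path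
    is blue. *)
Lemma virtual_path_wins n k h a b l :
  1 <= k -> forced_blue h a b -> NoDup l -> chain (virtual h a b) l -> n <= length l ->
  builder_wins n k h.
Proof.
  intros Hk Hf Hd Hc Hn.
  assert (Hover : forall h', incl h h' -> blue h' a b -> game_over n h').
  { intros h' Hi Hb; apply chain_game_over with l; trivial.
    apply chain_impl with (2 := Hc); intros x y [H | [[-> ->] | [-> ->]]]; trivial.
    - eapply colored_incl; eassumption.
    - apply colored_sym; exact Hb. }
  destruct Hf as [Hb | Hr].
  - apply builder_wins_over, Hover; auto using incl_refl.
  - apply builder_wins_forced with a b; trivial.
    intros; apply builder_wins_over, Hover; trivial.
Qed.

(** * Fresh vertices and growing histories *)

(** New vertices only have to avoid the current paths, not the whole history: [builder_wins_ask]
    copes with edges that already have a colour. *)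
Lemma exists_fresh (l : list nat) : exists y, ~ In y l.
Proof.
  exists (S (list_max l)); intros H.
  pose proof (proj1 (list_max_le l (list_max l)) (le_n _)) as Hm.
  rewrite Forall_forall in Hm; specialize (Hm _ H); lia.
Qed.

Lemma NoDup_app_neq (l l' : list nat) x y : NoDup (l ++ l') -> In x l -> In y l' -> x <> y.
Proof.
  intros Hd Hx Hy ->; apply in_split in Hx; destruct Hx as (l1 & l2 & ->).
  rewrite <- app_assoc in Hd; apply NoDup_remove_2 in Hd.
  apply Hd; rewrite !in_app_iff; auto.
Qed.

Lemma red_incl h h' x y : incl h h' -> red h x y -> red h' x y.
Proof. apply colored_incl. Qed.

Lemma blue_incl h h' x y : incl h h' -> blue h x y -> blue h' x y.
Proof. apply colored_incl. Qed.

Lemma chain_blue_incl h h' l : incl h h' -> chain (blue h) l -> chain (blue h') l.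
Proof. intros Hi; apply chain_impl; intros x y; apply blue_incl, Hi. Qed.

Lemma chain_virtual_incl h h' a b l :
  incl h h' -> chain (virtual h a b) l -> chain (virtual h' a b) l.
Proof. intros Hi; apply chain_impl; intros x y; apply virtual_incl, Hi. Qed.

Ltac lift Hi :=
  match type of Hi with incl ?h _ =>
    repeat match goal with
    | H : forced_blue h _ _ |- _ => apply (forced_blue_incl _ _ _ _ Hi) in H
    | H : red h _ _ |- _ => apply (red_incl _ _ _ _ Hi) in H
    | H : blue h _ _ |- _ => apply (blue_incl _ _ _ _ Hi) in H
    | H : chain (virtual h _ _) _ |- _ => apply (chain_virtual_incl _ _ _ _ _ Hi) in H
    | H : chain (blue h) _ |- _ => apply (chain_blue_incl _ _ _ Hi) in H
    end;
    clear Hi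
  end.

(** * Round counts for one path and for two linked paths *)

(** The bound [1 <= k] reserves the round for the virtual edge when the path is already long enough.
    The condition on the head edge is handed on to [linked_paths_win]. *)
Definition single_path_wins (n k : nat) : Prop :=
  forall h a b v u P,
    forced_blue h a b -> NoDup (v :: u :: P) -> chain (virtual h a b) (v :: u :: P) ->
    P = [] \/ blue h v u ->
    1 <= k -> 3 * n <= k + 2 * length (v :: u :: P) + 1 ->
    builder_wins n k h.

(* The disjunction serves the case of [n - 1] and [n - 2] vertices, where Builder
   cannot afford to play the virtual edge. *)
Definition linked_paths_win (n k : nat) : Prop :=
  forall h a b v u L x M,
    forced_blue h a b -> NoDup ((v :: u :: L) ++ x :: M) ->
    chain (virtual h a b) (v :: u :: L) -> chain (blue h) (x :: M) -> red h v x ->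
    length (v :: u :: L) < n -> length (x :: M) < n ->
    L = [] \/ length (v :: u :: L) <= length (x :: M) \/ blue h v u ->
    3 * n <= k + length (v :: u :: L) + length (x :: M)
             + max (length (v :: u :: L)) (length (x :: M)) + 1 ->
    builder_wins n k h.

(** Builder probes a new vertex from the head. Blue adds a vertex, worth two rounds, for the price
    of one. Red yields linked paths with [p] vertices and one vertex, whose round count is exactly
    one less. *)
Lemma single_path_step n k :
  (forall k', k' < k -> single_path_wins n k' /\ linked_paths_win n k') ->
  single_path_wins n k.
Proof.
  intros IH h a b v u P Hf Hd Hc Hvu Hk Hn.
  destruct (le_lt_dec n (length (v :: u :: P))) as [Hlen | Hlen];
    [eapply virtual_path_wins; eassumption |].
  destruct (exists_fresh (v :: u :: P)) as [x Hx].
  assert (IHk : single_path_wins n (k - 1) /\ linked_paths_win n (k - 1))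
    by (apply IH; lia).
  destruct IHk as [IHs IHl]; simpl length in *.
  assert (v <> x) by (intros ->; apply Hx; left; reflexivity).
  apply builder_wins_ask with v x; trivial.
  - intros h' Hi Hb; lift Hi.
    apply (IHs h' a b x v (u :: P)); simpl length; trivial; try lia.
    + constructor; trivial.
    + split; [left; apply colored_sym |]; trivial.
    + right; apply colored_sym; trivial.
  - intros h' Hi Hr.
    apply (IHl h' a b v u P x []); simpl length; trivial; try lia; try exact I.
    + lift Hi; trivial.
    + apply (Permutation_NoDup (Permutation_cons_append (v :: u :: P) x)).
      constructor; trivial.
    + lift Hi; trivial.
    + destruct Hvu as [H' | H']; [left | right; right; lift Hi]; trivial.
Qed.


(** * One step with two linked paths *)

Section LinkedStep.

Variables n k : nat.
Hypothesis IH : forall k', k' < k -> single_path_wins n k' /\ linked_paths_win n k'.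

Let single k' (lt : k' < k) : single_path_wins n k' := proj1 (IH k' lt).
Let linked k' (lt : k' < k) : linked_paths_win n k' := proj2 (IH k' lt).

Variables (h : history) (a b v u : nat) (L : list nat) (x : nat).
Hypothesis Hf : forced_blue h a b.
Hypothesis HL : chain (virtual h a b) (v :: u :: L).
Hypothesis Hvx : red h v x.

(** Here [x] is head and tail at once, so a red probe [x y] together with the red link [v x] forces
    [y v] without a further question. Both answers meet the round count exactly. *)
Lemma linked_step_singleton :
  NoDup ((v :: u :: L) ++ [x]) ->
  length (v :: u :: L) < n ->
  L = [] \/ blue h v u ->
  3 * n <= k + 2 * length (v :: u :: L) + 2 ->
  builder_wins n k h.
Proof.
  intros Hd Hln Hvu Hk.
  destruct (exists_fresh ((v :: u :: L) ++ [x])) as [y Hy].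
  assert (Hyd : NoDup (y :: (v :: u :: L) ++ [x])) by (constructor; trivial).
  assert (Hyv : y <> v) by (intros ->; apply Hy; left; reflexivity).
  assert (Hyx : y <> x) by (intros ->; apply Hy, in_elt).
  assert (Hvx' : v <> x) by (apply (NoDup_app_neq _ _ _ _ Hd); apply in_eq).
  simpl length in *.
  apply builder_wins_ask with x y; [lia | auto | |].
  - intros h1 Hi1 Hb.
    apply (linked (k - 1)) with a b v u L x [y]; simpl length; try lia.
    + lift Hi1; trivial.
    + apply (Permutation_NoDup (Permutation_cons_append _ y)) in Hyd.
      rewrite <- app_assoc in Hyd; exact Hyd.
    + lift Hi1; trivial.
    + split; trivial; exact I.
    + lift Hi1; trivial.
    + destruct Hvu as [H' | H']; [left | right; right; lift Hi1]; trivial.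
  - intros h1 Hi1 Hr; clear Hvu; lift Hi1.
    apply builder_wins_forced with y v; [lia | |].
    { exists x; repeat split; auto; apply colored_sym; trivial. }
    intros h2 Hi2 Hb; lift Hi2.
    destruct (le_lt_dec n (S (length (v :: u :: L)))) as [Hlen | Hlen].
    + apply virtual_path_wins with a b (y :: v :: u :: L); trivial.
      * simpl length in *; lia.
      * apply (NoDup_app_remove_r (y :: v :: u :: L) _ Hyd).
      * split; [left |]; trivial.
    + apply (linked (k - 1 - 1)) with a b y v (u :: L) x []; simpl length in *;
        trivial; try lia; try exact I.
      * split; [left |]; trivial.
      * apply colored_sym; trivial.
      * right; right; trivial.
Qed.

(** Two rounds suffice when each path lacks at most one vertex. A blue [y v] completes the left path
    and leaves a round for the virtual edge; a red one forces [y x], which completes the right path,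
    where every edge is truly blue. *)
Lemma linked_step_last M :
  NoDup ((v :: u :: L) ++ x :: M) -> chain (blue h) (x :: M) ->
  n <= S (length (v :: u :: L)) -> n <= S (length (x :: M)) -> 2 <= k ->
  builder_wins n k h.
Proof.
  intros Hd HM Hl Hm Hk.
  destruct (exists_fresh ((v :: u :: L) ++ x :: M)) as [y Hy].
  assert (Hyv : y <> v) by (intros ->; apply Hy; left; reflexivity).
  assert (Hyx : y <> x) by (intros ->; apply Hy, in_elt).
  assert (Hvx' : v <> x) by (apply (NoDup_app_neq _ _ _ _ Hd); apply in_eq).
  apply builder_wins_ask with y v; [lia | auto | |].
  - intros h1 Hi1 Hb; lift Hi1.
    apply virtual_path_wins with a b (y :: v :: u :: L); trivial; try lia.
    + constructor; [| exact (NoDup_app_remove_r (v :: u :: L) _ Hd)].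
      intros H; apply Hy, in_or_app; left; exact H.
    + split; [left |]; trivial.
  - intros h1 Hi1 Hr; lift Hi1.
    apply builder_wins_forced with y x; [lia | |].
    { exists v; repeat split; auto; apply colored_sym; trivial. }
    intros h2 Hi2 Hb; lift Hi2.
    apply builder_wins_over, chain_game_over with (y :: x :: M); trivial.
    + constructor; [| exact (NoDup_app_remove_l (v :: u :: L) _ Hd)].
      intros H; apply Hy, in_or_app; right; exact H.
    + split; trivial.
Qed.

(** The bound [n - 1] on the right path keeps it below [n] vertices after a blue probe, as
    [linked_paths_win] demands. *)
Lemma linked_step_right_shorter M z :
  NoDup ((v :: u :: L) ++ x :: M ++ [z]) -> chain (blue h) (x :: M ++ [z]) ->
  length (v :: u :: L) < n -> length (x :: M ++ [z]) < n - 1 ->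
  L = [] \/ length (v :: u :: L) <= length (x :: M ++ [z]) \/ blue h v u ->
  length (x :: M ++ [z]) <= length (v :: u :: L) ->
  3 * n <= k + 2 * length (v :: u :: L) + length (x :: M ++ [z]) + 1 ->
  builder_wins n k h.
Proof.
  intros Hd HM Hl Hm Hvu Hml Hk.
  destruct (exists_fresh ((v :: u :: L) ++ x :: M ++ [z])) as [y Hy].
  assert (Hyd : NoDup (y :: (v :: u :: L) ++ x :: M ++ [z])) by (constructor; trivial).
  assert (Hneq : y <> v /\ y <> x /\ y <> z /\ x <> z /\ v <> z /\ v <> x).
  { assert (Hz : In z (x :: M ++ [z])) by (right; apply in_elt).
    assert (Hyn : forall t, In t ((v :: u :: L) ++ x :: M ++ [z]) -> y <> t)
      by (intros t Ht ->; exact (Hy Ht)).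
    repeat split.
    - apply Hyn; left; reflexivity.
    - apply Hyn, in_elt.
    - apply Hyn, in_or_app; right; exact Hz.
    - apply (NoDup_app_neq [x] (M ++ [z])); [| apply in_eq | apply in_elt].
      exact (NoDup_app_remove_l (v :: u :: L) _ Hd).
    - apply (NoDup_app_neq _ _ _ _ Hd); [apply in_eq | exact Hz].
    - apply (NoDup_app_neq _ _ _ _ Hd); apply in_eq. }
  destruct Hneq as (Hyv & Hyx & Hyz & Hxz & Hvz & Hvx').
  assert (HdML : NoDup (y :: (x :: M ++ [z]) ++ v :: u :: L)).
  { apply Permutation_NoDup with (2 := Hyd), perm_skip, Permutation_app_comm. }
  assert (len : length (x :: M ++ [z]) = S (S (length M)))
    by (simpl; rewrite length_app; simpl; lia).
  rewrite len in *.
  apply builder_wins_ask with z y; [simpl length in *; lia | auto | |].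
  - intros h1 Hi1 Hb.
    assert (len' : length (x :: (M ++ [z]) ++ [y]) = S (S (S (length M))))
      by (simpl; rewrite !length_app; simpl; lia).
    apply (linked (k - 1)) with a b v u L x ((M ++ [z]) ++ [y]);
      try rewrite len'; simpl length in *; try lia.
    + lift Hi1; trivial.
    + apply (Permutation_NoDup (Permutation_cons_append _ y)) in Hyd.
      rewrite <- app_assoc in Hyd; exact Hyd.
    + lift Hi1; trivial.
    + rewrite <- app_assoc; simpl app; rewrite app_comm_cons.
      apply chain_app; trivial; [| exact I]; lift Hi1; trivial.
    + lift Hi1; trivial.
    + destruct Hvu as [H' | [H' | H']]; [left | right; left; lia | right; right; lift Hi1];
        trivial.
  - intros h1 Hi1 Hr.
    apply builder_wins_ask with y v; [simpl length in *; lia | auto | |].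
    + intros h2 Hi2 Hb; clear Hvu; lift Hi1; lift Hi2.
      destruct (le_lt_dec n (S (length (v :: u :: L)))) as [Hlen | Hlen].
      * apply virtual_path_wins with a b (y :: v :: u :: L); trivial.
        -- simpl length in *; lia.
        -- apply (NoDup_app_remove_r (y :: v :: u :: L) _ Hyd).
        -- split; [left |]; trivial.
      * assert (Hrev : rev (x :: M ++ [z]) = z :: rev M ++ [x])
          by (simpl; rewrite rev_app_distr; reflexivity).
        assert (len' : length (z :: rev M ++ [x]) = S (S (length M)))
          by (rewrite <- Hrev, length_rev; exact len).
        apply (linked (k - 1 - 1)) with a b y v (u :: L) z (rev M ++ [x]);
          try rewrite len'; simpl length in *; trivial; try lia.
        -- rewrite <- Hrev; apply Permutation_NoDup with (2 := Hyd), perm_skip.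
           apply (Permutation_app_head (v :: u :: L)), Permutation_rev.
        -- split; [left |]; trivial.
        -- rewrite <- Hrev; apply chain_rev; trivial.
           intros s t; apply colored_sym.
        -- apply colored_sym; trivial.
        (* The left path is now longer than the right one, but its new head edge [y v] is truly
           blue, which preserves the head condition. *)
        -- right; right; trivial.
    + intros h2 Hi2 Hr2.
      apply builder_wins_forced with z v; [simpl length in *; lia | |].
      { exists y; repeat split; auto; apply colored_sym; lift Hi2; trivial. }
      intros h3 Hi3 Hb3.
      assert (Hchain : chain (virtual h3 a b) ((x :: M ++ [z]) ++ v :: u :: L)).
      { lift Hi1; lift Hi2; lift Hi3.
        rewrite app_comm_cons, <- app_assoc.
        apply chain_app; trivial; [| left; trivial].
        revert HM; apply chain_impl; intros s t Hst; left; exact Hst. }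
      destruct (le_lt_dec n (S (length (v :: u :: L)))) as [Hlen | Hlen].
      * destruct (le_lt_dec 4 k) as [Hk4 | Hk4].
        -- apply virtual_path_wins with a b ((x :: M ++ [z]) ++ v :: u :: L);
             trivial; try lia.
           ++ lift Hi1; lift Hi2; lift Hi3; trivial.
           ++ inversion HdML; trivial.
           ++ rewrite length_app, len; simpl length in *; lia.
        (* Now [k = 3], the paths have [n - 1] and [n - 2] vertices, and no round is left for the
           virtual edge. The right path followed by [v] and [u] has [n] vertices; only the third
           alternative for the head edge is possible, so [v u] is truly blue. *)
        -- destruct Hvu as [-> | [H' | Huv]]; [simpl length in *; lia .. |].
           lift Hi1; lift Hi2; lift Hi3.
           apply builder_wins_over, chain_game_over with ((x :: M ++ [z]) ++ [v; u]).
           ++ apply (NoDup_app_remove_r _ L).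
              rewrite <- app_assoc; inversion HdML; trivial.
           ++ rewrite app_comm_cons, <- app_assoc; apply chain_app; trivial.
              split; trivial; exact I.
           ++ rewrite length_app, len; simpl length in *; lia.
      * clear Hvu; lift Hi1; lift Hi2; lift Hi3.
        apply builder_wins_forced with y x; [simpl length in *; lia | |].
        { exists v; repeat split; auto; apply colored_sym; trivial. }
        intros h4 Hi4 Hb4; lift Hi4.
        (* Four rounds have produced one path on [l + m + 1] vertices; the count holds because
           [m >= 2]. *)
        apply (single (k - 1 - 1 - 1 - 1)) with a b y x ((M ++ [z]) ++ v :: u :: L);
          trivial.
        -- simpl length in *; lia.
        -- split; [left |]; trivial.
        -- right; trivial.
        -- simpl length in *; lia.
        -- simpl length; rewrite !length_app; simpl length in *; lia.
Qed.

(** The roles are exchanged, but the virtual edge stays in the left path, which is now the shorter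
    one. Completing the longer path therefore never requires the reserved round. *)
Lemma linked_step_left_shorter L' z M :
  u :: L = L' ++ [z] ->
  NoDup ((v :: u :: L) ++ x :: M) -> chain (blue h) (x :: M) ->
  length (v :: u :: L) < length (x :: M) -> length (x :: M) < n ->
  3 * n <= k + 2 * length (x :: M) + length (v :: u :: L) + 1 ->
  builder_wins n k h.
Proof.
  intros HL' Hd HM Hlm Hm Hk.
  destruct (exists_fresh ((v :: u :: L) ++ x :: M)) as [y Hy].
  assert (Hyd : NoDup (y :: (v :: u :: L) ++ x :: M)) by (constructor; trivial).
  assert (Hneq : y <> v /\ y <> x /\ y <> z /\ v <> z /\ z <> x /\ v <> x).
  { assert (Hz : In z (v :: u :: L)) by (rewrite HL'; right; apply in_elt).
    assert (Hyn : forall t, In t ((v :: u :: L) ++ x :: M) -> y <> t)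
      by (intros t Ht ->; exact (Hy Ht)).
    repeat split.
    - apply Hyn; left; reflexivity.
    - apply Hyn, in_elt.
    - apply Hyn, in_or_app; left; exact Hz.
    - apply (NoDup_app_neq [v] (u :: L)); [| apply in_eq | rewrite HL'; apply in_elt].
      exact (NoDup_app_remove_r (v :: u :: L) _ Hd).
    - apply (NoDup_app_neq _ _ _ _ Hd); [exact Hz | apply in_eq].
    - apply (NoDup_app_neq _ _ _ _ Hd); apply in_eq. }
  destruct Hneq as (Hyv & Hyx & Hyz & Hvz & Hzx & Hvx').
  apply builder_wins_ask with z y; [simpl length in *; lia | auto | |].
  - intros h1 Hi1 Hb; lift Hi1.
    assert (len : length (v :: u :: L ++ [y]) = S (length (v :: u :: L)))
      by (simpl; rewrite length_app; simpl; lia).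
    apply (linked (k - 1)) with a b v u (L ++ [y]) x M;
      try rewrite len; trivial; try (simpl length in *; lia).
    + apply Permutation_NoDup with (2 := Hyd).
      change (v :: u :: L ++ [y]) with ((v :: u :: L) ++ [y]).
      rewrite <- app_assoc; apply Permutation_middle.
    + change (v :: u :: L ++ [y]) with (v :: (u :: L) ++ [y]); rewrite HL' in HL |- *.
      rewrite <- app_assoc; apply (chain_app _ (v :: L')); trivial; [left; trivial | exact I].
  - intros h1 Hi1 Hr; lift Hi1.
    apply builder_wins_ask with y x; [simpl length in *; lia | auto | |].
    + intros h2 Hi2 Hb; lift Hi2.
      destruct (le_lt_dec n (S (length (x :: M)))) as [Hlen | Hlen].
      * apply builder_wins_over, chain_game_over with (y :: x :: M); trivial.
        -- constructor; [| exact (NoDup_app_remove_l (v :: u :: L) _ Hd)].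
           intros H; apply Hy, in_or_app; right; exact H.
        -- split; trivial.
      * assert (Hrev : exists s t, rev (v :: u :: L) = z :: s :: t).
        { rewrite HL'; simpl; rewrite rev_app_distr; simpl.
          destruct (rev L' ++ [v]) as [| s t] eqn:E; [| exists s, t; reflexivity].
          destruct (rev L'); discriminate. }
        destruct Hrev as (s & t & Hrev).
        assert (len : length (z :: s :: t) = length (v :: u :: L))
          by (rewrite <- Hrev; apply length_rev).
        (* Reversal may bring the virtual edge to the head; this is allowed because the left path is
           still the shorter one. *)
        apply (linked (k - 1 - 1)) with a b z s t y (x :: M);
          try rewrite len; trivial; try (simpl length in *; lia).
        -- rewrite <- Hrev; apply Permutation_NoDup with (2 := Hyd).
           eapply Permutation_trans; [apply Permutation_middle |].
           apply Permutation_app_tail, Permutation_rev.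
        -- rewrite <- Hrev; apply chain_rev; trivial.
           intros; apply virtual_sym; trivial.
        -- split; trivial.
    + intros h2 Hi2 Hr2; lift Hi2.
      apply builder_wins_forced with z x; [simpl length in *; lia | |].
      { exists y; repeat split; auto; apply colored_sym; trivial. }
      intros h3 Hi3 Hb3; lift Hi3.
      destruct (le_lt_dec n (S (length (x :: M)))) as [Hlen | Hlen].
      (* The right path lacks one vertex, and [z] alone supplies it through a real blue edge. *)
      * apply builder_wins_over, chain_game_over with (z :: x :: M); trivial.
        -- apply (NoDup_app_remove_l (v :: L')).
           replace ((v :: L') ++ z :: x :: M) with ((v :: u :: L) ++ x :: M); trivial.
           rewrite HL'; simpl; rewrite <- app_assoc; reflexivity.
        -- split; trivial.
      * apply builder_wins_forced with y v; [simpl length in *; lia | |].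
        { exists x; repeat split; auto; apply colored_sym; trivial. }
        intros h4 Hi4 Hb4; lift Hi4.
        apply (single (k - 1 - 1 - 1 - 1)) with a b y v ((u :: L) ++ x :: M); trivial.
        -- simpl length in *; lia.
        -- split; [left; trivial |].
           rewrite HL' in HL |- *; rewrite <- app_assoc.
           apply (chain_app _ (v :: L')); trivial; [left; trivial |].
           apply chain_impl with (2 := HM); intros s t Hst; left; exact Hst.
        -- right; trivial.
        -- simpl length in *; lia.
        -- simpl length; rewrite !length_app; simpl length in *; lia.
Qed.

End LinkedStep.

(** * Induction on the rounds, and the opening *)

Lemma linked_paths_step n k :
  (forall k', k' < k -> single_path_wins n k' /\ linked_paths_win n k') ->
  linked_paths_win n k.
Proof.
  intros IH h a b v u L x M Hf Hd HL HM Hvx Hl Hm Hvu Hk.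
  destruct (le_lt_dec (length (x :: M)) (length (v :: u :: L))) as [Hml | Hlm].
  - destruct M as [| w M].
    + apply linked_step_singleton with a b v u L x; trivial; simpl length in *; try lia.
      destruct Hvu as [-> | [H | H]]; auto; lia.
    + destruct (@exists_last _ (w :: M)) as (M' & z & E); [discriminate |].
      rewrite E in *.
      (* As [m <= l < n], the first case means [l = m = n - 1], and the count then gives
         [k >= 2]. *)
      destruct (le_lt_dec (n - 1) (length (x :: M' ++ [z]))).
      * apply linked_step_last with a b v u L x (M' ++ [z]); trivial; lia.
      * apply linked_step_right_shorter with a b v u L x M' z; trivial; lia.
  - destruct (@exists_last _ (u :: L)) as (L' & z & E); [discriminate |].
    apply linked_step_left_shorter with a b v u L x L' z M; trivial; lia.
Qed.

(** The two claims call each other with up to four rounds fewer, hence a joint strong induction. *)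
Lemma path_strategies_win n k : single_path_wins n k /\ linked_paths_win n k.
Proof.
  induction k as [k IH] using lt_wf_ind.
  split; [apply single_path_step | apply linked_paths_step]; exact IH.
Qed.

Theorem theorem2 : forall n : nat, 3 <= n -> online_ramsey_C3_Pn_le n (3 * n - 4).
Proof.
  intros n Hn; unfold online_ramsey_C3_Pn_le.
  assert (Hd : NoDup [0; 1; 2]) by (repeat constructor; simpl; lia).
  apply builder_wins_ask with 0 1; [lia .. | |].
  - intros h _ Hb.
    apply (proj1 (path_strategies_win n (3 * n - 4 - 1)) h 0 1 0 1 []);
      simpl length; try lia.
    + left; exact Hb.
    + exact (NoDup_app_remove_r [0; 1] [2] Hd).
    + split; [left; exact Hb | exact I].
    + left; reflexivity.
  - intros h _ Hr.
    apply builder_wins_ask with 0 2; [lia .. | |]; intros h' Hi Hc; lift Hi.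
    (* With [l = 2] and [m = 1] the count is [3 n - 6], exactly what two opening rounds leave. *)
    + apply (proj2 (path_strategies_win n (3 * n - 4 - 1 - 1)) h' 0 2 0 2 [] 1 []);
        simpl length; trivial; try lia; try exact I.
      * left; exact Hc.
      * apply Permutation_NoDup with (2 := Hd), perm_skip, perm_swap.
      * split; [left; exact Hc | exact I].
      * left; reflexivity.
    (* Two red edges at [0] force [1 2], which counts as a path of two vertices without being
       played; the red edge [0 1] links it to the single vertex [0]. *)
    + apply (proj2 (path_strategies_win n (3 * n - 4 - 1 - 1)) h' 1 2 1 2 [] 0 []);
        simpl length; trivial; try lia; try exact I.
      * right; exists 0; repeat split; trivial; lia.
      * apply (Permutation_NoDup (Permutation_cons_append [1; 2] 0) Hd).
      * split; [right; auto | exact I].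
      * apply colored_sym; exact Hr.
      * left; reflexivity.
Qed.
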